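(* If $G$ and $H$ are critical graphs, then $G\,\nabla H$ is also critical.
   Context: All graphs are finite and simple; $|G|$ denotes the number of vertices of $G$. A coloring of a graph $G=(V,E)$ is a surjective map $\ell:V\to C$ onto a finite set $C$ of colors; it need not be proper. It is pseudocomplete if for any two distinct colors $i,j\in C$ there is an edge $uv\in E$ with $\{\ell(u),\ell(v)\}=\{i,j\}$. The pseudoachromatic number $\Psi(G)$ is the greatest number of colors used in a pseudocomplete coloring of $G$ (so $\Psi$ of the graph with no vertices is $0$). $G\,\nabla H$ is the join: the disjoint union of $G$ and $H$ together with all edges between a vertex of $G$ and a vertex of $H$. For an integer $0\le k\le |G|$, $\operatorname{mpd}_G(k)=\min\{\Psi(G)-\Psi(G\setminus X) : X\subseteq V,\ |X|=k\}$, where $G\setminus X$ is the subgraph induced on $V\setminus X$. $G$ is critical if $\operatorname{mpd}_G(k)\ge\lceil k/2\rceil$ for all $0\le k\le |G|$. *)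

(* Defs.v *)
From mathcomp Require Import all_boot.

Set Implicit Arguments.
Unset Strict Implicit.
Unset Printing Implicit Defensive.

Record sgraph := SGraph {
  vertex :> finType;
  edge : rel vertex;
  edge_sym : symmetric edge;
  edge_irr : irreflexive edge }.

Section Induced.
Variables (G : sgraph) (X : {set G}).

Let del_vertex : finType := {x : G | x \notin X}.
Let del_edge : rel del_vertex := fun u v => edge (val u) (val v).

Fact del_edge_sym : symmetric del_edge.
Proof. by move=> u v; apply: edge_sym. Qed.

Fact del_edge_irr : irreflexive del_edge.
Proof. by move=> u; apply: edge_irr. Qed.

Definition gdel : sgraph := SGraph del_edge_sym del_edge_irr.

End Induced.

Section Join.
Variables G H : sgraph.

Definition join_edge (u v : G + H) : bool :=
  match u, v with
  | inl x, inl y => edge x y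
  | inr x, inr y => edge x y
  | _, _ => true
  end.

Fact join_edge_sym : symmetric join_edge.
Proof. by case=> x [] y //=; apply: edge_sym. Qed.

Fact join_edge_irr : irreflexive join_edge.
Proof. by case=> x /=; apply: edge_irr. Qed.

Definition gjoin : sgraph := SGraph join_edge_sym join_edge_irr.

End Join.

Definition coloring (G : sgraph) (C : finType) (l : G -> C) : bool :=
  [forall c, exists v, l v == c].

Definition pseudocomplete (G : sgraph) (C : finType) (l : G -> C) : bool :=
  [forall i : C, forall j : C, (i != j) ==>
    [exists u : G, exists v : G, edge u v && ([set l u; l v] == [set i; j])]].

(* The color set is taken to be 'I_n, without loss of generality; the bound
   n <= #|G| follows from surjectivity, and n = 0 is attained exactly when G
   has no vertices. *)
Definition Psi (G : sgraph) : nat :=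
  \max_(n < #|G|.+1 |
    [exists l : {ffun G -> 'I_n}, coloring l && pseudocomplete l]) n.

(* The default value Psi G of the minimum bounds all the differences, so it
   matters only when no X has k elements, i.e., when #|G| < k; the subtraction
   is not truncated, by leq_Psi_gdel below. *)
Definition mpd (G : sgraph) (k : nat) : nat :=
  \big[minn/Psi G]_(X : {set G} | #|X| == k) (Psi G - Psi (gdel X)).

(* uphalf k is the ceiling of k / 2. *)
Definition critical (G : sgraph) : Prop :=
  forall k : nat, k <= #|G| -> uphalf k <= mpd G k.

Lemma leq_Psi (G : sgraph) (C : finType) (l : G -> C) :
  coloring l -> pseudocomplete l -> #|C| <= Psi G.
Proof.
move=> /forallP sl /forallP pl.
have leC : #|C| < #|G|.+1.
  rewrite ltnS -(_ : #|codom l| = #|C|) ?leq_image_card //.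
  by apply: eq_card => c; have /existsP[v /eqP <-] := sl c; rewrite codom_f.
apply: (bigmax_sup (Ordinal leC)) => //=.
apply/existsP; exists [ffun v => enum_rank (l v)]; apply/andP; split.
  apply/forallP => c; have /existsP[v /eqP lv] := sl (enum_val c).
  by apply/existsP; exists v; rewrite ffunE lv enum_valK.
apply/forallP => i; apply/forallP => j; apply/implyP => nij.
have /forallP/(_ (enum_val j)) := pl (enum_val i).
rewrite (inj_eq enum_val_inj) nij => /existsP[u /existsP[v /andP[uv /eqP E]]].
apply/existsP; exists u; apply/existsP; exists v; rewrite uv !ffunE /=.
have := congr1 (fun A : {set C} => [set enum_rank x | x in A]) E.
by rewrite !imsetU !imset_set1 !enum_valK => ->.
Qed.

Lemma Psi_attained (G : sgraph) :
  exists l : G -> 'I_(Psi G), coloring l && pseudocomplete l.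
Proof.
have [G0|/card_gt0P[x0 _]] := posnP #|G|.
  have P0 : Psi G = 0.
    by apply/eqP; rewrite -leqn0; apply/bigmax_leqP => n _; rewrite -ltnS -G0.
  have noG (x : G) : False by have := fintype0 x G0.
  exists (fun x => False_rect _ (noG x)); apply/andP; split.
    by apply/forallP => c; have := ltn_ord c; rewrite {2}P0.
  by apply/forallP => c; have := ltn_ord c; rewrite {2}P0.
pose P (n : 'I_#|G|.+1) :=
  [exists l : {ffun G -> 'I_n}, coloring l && pseudocomplete l].
have c1 : 1 < #|G|.+1 by rewrite ltnS; apply/card_gt0P; exists x0.
have P1 : P (Ordinal c1).
  apply/existsP; exists [ffun=> ord0]; apply/andP; split.
    by apply/forallP => c; apply/existsP; exists x0; rewrite ffunE (ord1 c).
  by apply/forallP => c; apply/forallP => d; rewrite (ord1 c) (ord1 d) eqxx.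
have [n Pn ->] : {n | P n & Psi G = n}.
  by apply: eq_bigmax_cond; apply/card_gt0P; exists (Ordinal c1).
by have /existsP[l hl] := Pn; exists l.
Qed.

Lemma leq_Psi_gdel (G : sgraph) (X : {set G}) : Psi (gdel X) <= Psi G.
Proof.
have [|n0] := posnP (Psi (gdel X)); first by move=> ->.
have [l /andP[/forallP sl /forallP pl]] := Psi_attained (gdel X).
pose l' (x : G) := oapp l (Ordinal n0) (insub x).
have l'E (u : gdel X) : l' (val u) = l u by rewrite /l' valK.
rewrite -[leqLHS]card_ord; apply: (@leq_Psi _ _ l').
  apply/forallP => c; have /existsP[v /eqP <-] := sl c.
  by apply/existsP; exists (val v); rewrite l'E.
apply/forallP => i; apply/forallP => j; apply/implyP => nij.
have /forallP/(_ j)/implyP/(_ nij)/existsP[u /existsP[v /andP[uv E]]] := pl i.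
by apply/existsP; exists (val u); apply/existsP; exists (val v); rewrite !l'E E andbT.
Qed.

Lemma leq_mpd (G : sgraph) (k m : nat) : k <= #|G| ->
  (m <= mpd G k) =
  [forall X : {set G}, (#|X| == k) ==> (m <= Psi G - Psi (gdel X))].
Proof.
move=> kG; have /set0Pn[X0] : [set X : {set G} | #|X| == k] != set0.
  by rewrite -card_gt0 card_draws bin_gt0.
rewrite inE => X0k.
apply/idP/forallP => [mk X | mX].
  apply/implyP => Xk; apply: leq_trans mk _.
  rewrite /mpd; elim: (index_enum _) (mem_index_enum X) => // Y s IH.
  rewrite inE big_cons => /predU1P[<-|/IH {}IH]; first by rewrite Xk geq_minl.
  by case: ifP => // _; apply: leq_trans (geq_minr _ _) IH.
rewrite /mpd; elim/big_ind: _ => [|a b ma mb|X Xk].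
- by apply: leq_trans (leq_subr _ _); apply: (implyP (mX X0)).
- by rewrite leq_min ma mb.
- exact: (implyP (mX X)).
Qed.

(* Main.v *)
Require Import Defs.
From mathcomp Require Import all_boot.
From mathcomp Require Import zify.

(** Fix an optimal coloring of the join with a vertex set [X] deleted, where
    [X] has [a] vertices in [G] and [b] in [H].  Its [n] color classes are of
    three kinds: [p] of them lie inside [G], [q] lie inside [H], and [m] are
    mixed.  Two classes inside [G] can only be joined by an edge of [G], so the
    [p] classes form a pseudocomplete coloring of a graph obtained from [G] by
    deleting the [a] vertices of [X] and at least one more vertex for each
    mixed class.  As [G] is critical, [Psi G >= p + ceil((a + m) / 2)]
    ([critical_partial_coloring]), and likewise
    [Psi H >= q + ceil((b + m) / 2)].  Adding these, and using that [Psi] is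
    superadditive under joins ([Psi_join]),
      [Psi (gjoin G H) >= p + q + m + ceil((a + b) / 2)
                        = n + ceil(#|X| / 2)].
    So a mixed class pays for itself: it costs one vertex on each side, and the
    two halves gained from criticality add up to one color. *)

Lemma critical_gdel (G : sgraph) (X : {set G}) :
  critical G -> uphalf #|X| + Psi (gdel X) <= Psi G.
Proof.
move=> cG; have XG : #|X| <= #|G| by apply: max_card.
have := cG _ XG; rewrite (leq_mpd _ XG) => /forallP/(_ X).
by rewrite eqxx /= leq_subRL ?leq_Psi_gdel // addnC.
Qed.

(** The ends of the edge can be chosen in a prescribed order because [edge] is
    symmetric. *)
Lemma pseudocomplete_edge {G : sgraph} {C : finType} {l : G -> C} {i j : C} :
  pseudocomplete l -> i != j -> exists u v, [/\ edge u v, l u = i & l v = j].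
Proof.
move=> /forallP/(_ i)/forallP/(_ j)/implyP pl nij.
have /existsP[u /existsP[v /andP[uv /eqP E]]] := pl nij.
have := set22 i j; have := set21 i j; rewrite -E !inE.
move=> /orP[]/eqP iE /orP[]/eqP jE.
- by rewrite iE jE eqxx in nij.
- by exists u, v.
- by exists v, u; rewrite edge_sym.
- by rewrite iE jE eqxx in nij.
Qed.

(** The union of optimal colorings of the two sides with disjoint color sets is
    pseudocomplete, since colors from different sides always see each other. *)
Lemma Psi_join (G H : sgraph) : Psi G + Psi H <= Psi (gjoin G H).
Proof.
have [lG /andP[/forallP sG pG]] := Psi_attained G.
have [lH /andP[/forallP sH pH]] := Psi_attained H.
pose l (x : gjoin G H) : 'I_(Psi G) + 'I_(Psi H) :=
  match x with inl u => inl (lG u) | inr v => inr (lH v) end.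
have -> : Psi G + Psi H = #|{: 'I_(Psi G) + 'I_(Psi H)}|.
  by rewrite card_sum !card_ord.
apply: (@leq_Psi _ _ l).
  apply/forallP => -[] c.
    by have /existsP[v /eqP <-] := sG c; apply/existsP; exists (inl v).
  by have /existsP[v /eqP <-] := sH c; apply/existsP; exists (inr v).
apply/forallP => i; apply/forallP => j; apply/implyP => nij.
suff [u [v [uv lu lv]]] : exists u v, [/\ edge u v, l u = i & l v = j].
  by apply/existsP; exists u; apply/existsP; exists v; rewrite uv lu lv eqxx.
case: i j nij => [i|i] [j|j] nij.
- have [u [v [uv <- <-]]] := pseudocomplete_edge pG nij.
  by exists (inl u), (inl v).
- have /existsP[u /eqP <-] := sG i; have /existsP[v /eqP <-] := sH j.
  by exists (inl u), (inr v).
- have /existsP[u /eqP <-] := sH i; have /existsP[v /eqP <-] := sG j.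
  by exists (inr u), (inl v).
- have [u [v [uv <- <-]]] := pseudocomplete_edge pH nij.
  by exists (inr u), (inr v).
Qed.

(** [None] marks an uncolored vertex.  With partial colorings of the whole
    graph, a coloring of [gdel X] restricts to either side of a join without
    passing through subtypes. *)
Definition used {G : sgraph} {C : finType} (f : G -> option C) : {set C} :=
  [set c | [exists x, f x == Some c]].

(** Criticality applied to the set [Y] of all vertices without a color in [D]:
    the classes of the colors in [D] color its complement, and besides the
    uncolored vertices [Y] contains a vertex of each used color outside [D]. *)
Lemma critical_partial_coloring (G : sgraph) (C : finType)
    (f : G -> option C) (D : {set C}) :
    critical G -> D \subset used f ->
    {in D &, forall i j, i != j ->
       exists u v, [/\ edge u v, f u = Some i & f v = Some j]} ->
  #|D| + uphalf (#|[set x | f x == None]| + #|used f :\: D|) <= Psi G.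
Proof.
move=> cG DU pD; have SI : injective (@Some C) by move=> ? ? [].
pose Y := [set x | f x \notin [set Some c | c in D]].
have inY c x : f x = Some c -> (x \in Y) = (c \notin D).
  by move=> fx; rewrite inE fx (mem_imset _ _ SI).
have leY : #|[set x | f x == None]| + #|used f :\: D| <= #|Y|.
  pose Z := [set x | f x \in [set Some c | c in used f :\: D]].
  have leZ : #|used f :\: D| <= #|Z|.
    rewrite -(card_imset _ SI).
    apply: leq_trans (leq_imset_card f Z).
    apply/subset_leq_card/subsetP => _ /imsetP[c cUD ->].
    have := cUD; rewrite !inE => /andP[_ /existsP[x /eqP fx]].
    by rewrite -fx imset_f // inE fx imset_f.
  have disj : [disjoint [set x | f x == None] & Z].
    rewrite disjoints_subset; apply/subsetP => x; rewrite !inE => /eqP ->.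
    by apply/imsetP => -[].
  apply: (@leq_trans #|[set x | f x == None] :|: Z|).
    by rewrite cardsU disjoint_setI0 // cards0 subn0 leq_add2l.
  apply/subset_leq_card/subsetP => x; rewrite !inE => /orP[/eqP->|].
    by apply/imsetP => -[].
  by move=> /imsetP[c /setDP[_ cD] ->]; rewrite (mem_imset _ _ SI).
have leD : #|D| <= Psi (gdel Y).
  have colP (x : gdel Y) : {c : {c | c \in D} | f (val x) = Some (val c)}.
    have := valP x; case E: (f (val x)) => [c|].
      by rewrite (inY _ _ E) negbK => cD; exists (exist _ c cD).
    by rewrite inE E => /negP[]; apply/imsetP => -[].
  pose l (x : gdel Y) := sval (colP x).
  have lift x c : f x = Some (val c) -> exists u : gdel Y, val u = x /\ l u = c.
    move=> fx; have xY : x \notin Y by rewrite (inY _ _ fx) negbK (valP c).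
    exists (exist _ x xY); split=> //; apply: val_inj; apply: SI.
    by rewrite -fx /l; case: (colP _).
  have -> : #|D| = #|{: {c | c \in D}}| by rewrite card_sig; apply: eq_card.
  apply: (@leq_Psi _ _ l).
    apply/forallP => c; have := subsetP DU _ (valP c).
    rewrite inE => /existsP[x /eqP /lift[u [_ <-]]].
    by apply/existsP; exists u.
  apply/forallP => i; apply/forallP => j; apply/implyP => nij.
  have [u [v [uv /lift[u' [Eu <-]] /lift[v' [Ev <-]]]]] :=
    pD _ _ (valP i) (valP j) nij.
  by apply/existsP; exists u'; apply/existsP; exists v'; rewrite /= Eu Ev uv eqxx.
apply: leq_trans (critical_gdel _ Y cG); rewrite addnC.
by rewrite leq_add //; apply: uphalf_leq.
Qed.

Theorem theorem3p5 (G H : sgraph) (cG : critical G) (cH : critical H) :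
  critical (gjoin G H).
Proof.
move=> k kle; rewrite (leq_mpd _ kle); apply/forallP => X.
apply/implyP => /eqP <-; rewrite leq_subRL ?leq_Psi_gdel //.
have [l /andP[/forallP sl pl]] := Psi_attained (gdel X).
set n := Psi (gdel X) in l sl pl *.
pose f (x : gjoin G H) : option 'I_n := omap l (insub x).
have fE u : f (val u) = Some (l u) by rewrite /f valK.
have f0 x : (f x == None) = (x \in X).
  by rewrite /f; case: insubP => [u /negPf->|/negPn].
pose fG (x : G) := f (inl x); pose fH (x : H) := f (inr x).
(* Colors outside [used fH] are those of the classes inside [G], colors outside
   [used fG] those of the classes inside [H]; the mixed ones are in both. *)
have usedT : used fG :|: used fH = [set: 'I_n].
  apply/setP => c; rewrite !inE; have /existsP[u /eqP <-] := sl c.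
  have := fE u; case: (val u) => x E; apply/orP; [left|right];
    by apply/existsP; exists x; apply/eqP.
have pf i j : i != j -> exists u v, [/\ edge u v, f u = Some i & f v = Some j].
  move=> /(pseudocomplete_edge pl)[u [v [uv <- <-]]].
  by exists (val u), (val v); rewrite !fE.
have notG x c : f (inl x) = Some c -> c \notin ~: used fG.
  by move=> E; rewrite !inE negbK; apply/existsP; exists x; apply/eqP.
have notH x c : f (inr x) = Some c -> c \notin ~: used fH.
  by move=> E; rewrite !inE negbK; apply/existsP; exists x; apply/eqP.
have boundG : #|~: used fH| +
    uphalf (#|[set x | fG x == None]| + #|used fG :&: used fH|) <= Psi G.
  have -> : used fG :&: used fH = used fG :\: ~: used fH by rewrite setDE setCK.
  apply: critical_partial_coloring => // [|i j iH jH /pf [u [v [uv]]]].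
    by rewrite -setTD -usedT subDset setUC.
  case: u v uv => x [] y //= xy fx fy; first by exists x, y.
  - by case/negP: (notH _ _ fy).
  - by case/negP: (notH _ _ fx).
  - by case/negP: (notH _ _ fx).
have boundH : #|~: used fG| +
    uphalf (#|[set x | fH x == None]| + #|used fG :&: used fH|) <= Psi H.
  have -> : used fG :&: used fH = used fH :\: ~: used fG.
    by rewrite setDE setCK setIC.
  apply: critical_partial_coloring => // [|i j iH jH /pf [u [v [uv]]]].
    by rewrite -setTD -usedT subDset.
  case: u v uv => x [] y //= xy fx fy; last by exists x, y.
  - by case/negP: (notG _ _ fx).
  - by case/negP: (notG _ _ fx).
  - by case/negP: (notG _ _ fy).
have cardX : #|X| = #|[set x | fG x == None]| + #|[set x | fH x == None]|.
  rewrite -!sum1dep_card -sum1_card big_sumType /=.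
  by congr (_ + _); apply: eq_bigl => x; rewrite /fG /fH f0.
have cardn : #|~: used fH| + #|~: used fG| + #|used fG :&: used fH| = n.
  have := cardsUI (used fG) (used fH); rewrite usedT cardsT card_ord.
  have := cardsC (used fG); have := cardsC (used fH); rewrite !card_ord; lia.
(* The arithmetic core is
   [uphalf (a + m) + uphalf (b + m) >= m + uphalf (a + b)]. *)
have := Psi_join G H; lia.
Qed.
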